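(* Let $(A,\mathfrak{m}_A) \to (B,\mathfrak{m}_B)$ be a local morphism of noetherian local rings, and let $Y$ be a finitely generated $B$-module, regarded as an $A$-module via $A \to B$. Then the following assertions are equivalent: (i) $Y$ is a flat $A$-module. (ii) $\operatorname{Tor}^A_1(Y, k_A) = 0$, where $k_A = A/\mathfrak{m}_A$.
   Context: All rings are commutative with unit. A local morphism $(A,\mathfrak{m}_A) \to (B,\mathfrak{m}_B)$ is a ring homomorphism of local rings mapping $\mathfrak{m}_A$ into $\mathfrak{m}_B$. $Y$ is not assumed to be finitely generated over $A$. *)

(* Defs.v *)
From HB Require Import structures.
From mathcomp Require Import all_boot all_algebra.
From mathcomp Require Import generic_quotient ring_quotient boolp.
From mathcomp.multinomials Require Import freeg.

Set Implicit Arguments.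
Unset Strict Implicit.
Unset Printing Implicit Defensive.

Import GRing.Theory.
Local Open Scope ring_scope.
Local Open Scope quotient_scope.

(* Submodules are [submodClosed V]; classically (boolp) every subset of V     *)
(* satisfying the closure axioms is of this form.  Ideals are submodules of   *)
(* the regular module A^o (which include the unit ideal, unlike [idealr A]).  *)

Notation ideal A := (submodClosed A^o).

Section Submodules.
Variables (A : comNzRingType) (V : lmodType A).

Record sub_lmod (S : submodClosed V) : Type :=
  SubLmod { sub_lmod_val :> V; _ : sub_lmod_val \in S }.

HB.instance Definition _ (S : submodClosed V) := [isSub for @sub_lmod_val S].
HB.instance Definition _ (S : submodClosed V) := [Choice of sub_lmod S by <:].
HB.instance Definition _ (S : submodClosed V) :=
  [SubChoice_isSubLmodule of sub_lmod S by <:].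

Section Gen.
Variable P : V -> Prop.

Definition gen : {pred V} := fun v =>
  `[< forall S : submodClosed V, (forall x, P x -> x \in S) -> v \in S >].

Fact gen_closed : submod_closed gen.
Proof.
split=> [|a u v /asboolP hu /asboolP hv]; apply/asboolP => S PS.
  exact: (submodClosedP S).1.
exact: (submodClosedP S).2 (hu S PS) (hv S PS).
Qed.
HB.instance Definition _ := GRing.isSubmodClosed.Build A V gen gen_closed.

Lemma mem_gen x : P x -> x \in gen.
Proof. by move=> Px; apply/asboolP => S; apply. Qed.

Lemma gen_min (S : submodClosed V) :
  (forall x, P x -> x \in S) -> {subset gen <= S}.
Proof. by move=> PS x /asboolP; apply. Qed.

End Gen.

Section Quot.
Variable S : submodClosed V.

Fact submod_zmod_closed : zmod_closed S.
Proof.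
have [S0 SD] := submodClosedP S; split=> // u v Su Sv.
by rewrite -scaleN1r addrC; apply: SD.
Qed.

Definition zmod_of_submod : {pred V} := S.
HB.instance Definition _ :=
  GRing.isZmodClosed.Build V zmod_of_submod submod_zmod_closed.

Definition quot_lmod : Type := Quotient.quot zmod_of_submod.
HB.instance Definition _ := GRing.Zmodule.on quot_lmod.

Definition qpi (v : V) : quot_lmod := \pi_(Quotient.quot zmod_of_submod) v.
Definition qrepr (x : quot_lmod) : V :=
  repr (x : Quotient.quot zmod_of_submod).

Lemma qreprK : cancel qrepr qpi.
Proof. exact: reprK. Qed.

Lemma qpi_eq u v : (qpi u == qpi v) = (u - v \in S).
Proof. by rewrite -[LHS](Quotient.idealrBE zmod_of_submod). Qed.

Lemma qpiB : zmod_morphism qpi.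
Proof. exact: (raddfB (\pi_(Quotient.quot zmod_of_submod))). Qed.

Definition qscale a (x : quot_lmod) := qpi (a *: qrepr x).

Lemma qpiZ a v : qpi (a *: v) = qscale a (qpi v).
Proof.
by apply/eqP; rewrite qpi_eq -scalerBr rpredZ // -qpi_eq qreprK.
Qed.

Lemma qpiD u v : qpi (u + v) = qpi u + qpi v.
Proof. exact: (raddfD (\pi_(Quotient.quot zmod_of_submod))). Qed.

Fact qscaleA a b x : qscale a (qscale b x) = qscale (a * b) x.
Proof. by rewrite -[x]qreprK -!qpiZ scalerA. Qed.
Fact qscale1 : left_id 1 qscale.
Proof. by move=> x; rewrite -[x]qreprK -qpiZ scale1r. Qed.
Fact qscaleDr : right_distributive qscale +%R.
Proof.
by move=> a x y; rewrite -[x]qreprK -[y]qreprK -qpiD -!qpiZ -qpiD scalerDr.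
Qed.
Fact qscaleDl v : {morph qscale^~ v : a b / a + b}.
Proof. by move=> a b; rewrite -[v]qreprK -!qpiZ -qpiD scalerDl. Qed.

HB.instance Definition _ := GRing.Zmodule_isLmodule.Build A quot_lmod
  qscaleA qscale1 qscaleDr qscaleDl.

Fact qpi_linear : linear qpi.
Proof. by move=> a u v; rewrite qpiD qpiZ. Qed.
HB.instance Definition _ := GRing.isLinear.Build A V quot_lmod _ qpi qpi_linear.

Section QuotLift.
Variables (W : lmodType A) (f : {linear V -> W}).

Definition quot_lift (x : quot_lmod) : W := f (qrepr x).

Hypothesis fS : {in S, forall v, f v = 0}.

Lemma quot_liftE v : quot_lift (qpi v) = f v.
Proof.
apply/eqP; rewrite /quot_lift -subr_eq0 -raddfB.
by apply/eqP/fS; rewrite -qpi_eq qreprK.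
Qed.

Lemma quot_lift_linear : linear quot_lift.
Proof.
move=> a x y; rewrite -[x]qreprK -[y]qreprK -linearZ -raddfD !quot_liftE.
by rewrite linearP.
Qed.

End QuotLift.
End Quot.
End Submodules.

Definition lin_id (A : comNzRingType) (M : lmodType A) : {linear M -> M} :=
  idfun.

Definition lin_zero (A : comNzRingType) (M N : lmodType A) : {linear M -> N} :=
  \0.

Section KerIm.
Variables (A : comNzRingType) (U V W : lmodType A).
Variables (f : {linear U -> V}) (g : {linear V -> W}).

Definition lin_ker : {pred V} := fun v => g v == 0.

Fact lin_ker_closed : submod_closed lin_ker.
Proof.
split=> [|a u v /eqP gu /eqP gv]; apply/eqP; first exact: raddf0.
by rewrite linearP gu gv scaler0 addr0.
Qed.
HB.instance Definition _ := GRing.isSubmodClosed.Build A V lin_ker lin_ker_closed.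

Definition exact_at : Prop := forall v, g v = 0 <-> exists u, f u = v.

(* For f, g composable with g \o f = 0, this is the submodule im f of ker g.  *)
Definition boundary : {pred sub_lmod lin_ker} := fun z =>
  `[< exists u, f u = val z >].

Fact boundary_closed : submod_closed boundary.
Proof.
split=> [|a x y /asboolP[u fu] /asboolP[v fv]]; apply/asboolP.
  by exists 0; rewrite !raddf0.
by exists (a *: u + v); rewrite !linearP fu fv.
Qed.
HB.instance Definition _ :=
  GRing.isSubmodClosed.Build A (sub_lmod lin_ker) boundary boundary_closed.

Definition homology : lmodType A := quot_lmod boundary.

End KerIm.

Section FreeModule.
Variables (A : comNzRingType) (K : choiceType) (W : lmodType A) (f : K -> W).

Fact fglift_linear : linear (fglift f : {freeg K / A} -> W).
Proof.
have fgB := @lift_is_additive A K W f.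
have fg0 : fglift f (0 : {freeg K / A}) = 0.
  by rewrite -(subrr (0 : {freeg K / A})) fgB subrr.
have fgD x y : fglift f (x + y : {freeg K / A}) = fglift f x + fglift f y.
  by rewrite -[y in LHS]opprK fgB -(sub0r y) fgB fg0 sub0r opprK.
have fgsum (s : seq K) (c : K -> A) :
    fglift f (\sum_(x <- s) << c x *g x >> : {freeg K / A})
    = \sum_(x <- s) c x *: f x.
  elim: s => [|x s IHs]; first by rewrite !big_nil.
  by rewrite !big_cons fgD IHs liftU.
have fgE (D : {freeg K / A}) : fglift f D = \sum_(x <- dom D) coeff x D *: f x.
  by rewrite -fgsum freeg_sumE.
move=> a D y; rewrite [LHS]fgD; congr (_ + _).
rewrite (fgE D) scaler_sumr [LHS](fgsum (dom D) (fun x => a * coeff x D)).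
by apply: eq_bigr => x _; rewrite scalerA.
Qed.
HB.instance Definition _ :=
  GRing.isLinear.Build A {freeg K / A} W _ (fglift f) fglift_linear.

End FreeModule.

Section Tensor.
Variables (A : comNzRingType) (M N : lmodType A).

Inductive tensor_rel : {freeg (M * N)%type / A} -> Prop :=
| TensorDl m m' n :
    tensor_rel (<< (m + m', n) >> - << (m, n) >> - << (m', n) >>)
| TensorDr m n n' :
    tensor_rel (<< (m, n + n') >> - << (m, n) >> - << (m, n') >>)
| TensorZl a m n : tensor_rel (<< (a *: m, n) >> - a *: << (m, n) >>)
| TensorZr a m n : tensor_rel (<< (m, a *: n) >> - a *: << (m, n) >>).

Definition tensor : lmodType A := quot_lmod (gen tensor_rel).

Definition tens (m : M) (n : N) : tensor :=
  qpi (gen tensor_rel) << (m, n) >>.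

Lemma tensDl m m' n : tens (m + m') n = tens m n + tens m' n.
Proof.
apply/eqP; rewrite -raddfD qpi_eq opprD addrA; apply: mem_gen.
exact: TensorDl.
Qed.

Lemma tensDr m n n' : tens m (n + n') = tens m n + tens m n'.
Proof.
apply/eqP; rewrite -raddfD qpi_eq opprD addrA; apply: mem_gen.
exact: TensorDr.
Qed.

Lemma tensZl a m n : tens (a *: m) n = a *: tens m n.
Proof.
by apply/eqP; rewrite -linearZ qpi_eq; apply: mem_gen; exact: TensorZl.
Qed.

Lemma tensZr a m n : tens m (a *: n) = a *: tens m n.
Proof.
by apply/eqP; rewrite -linearZ qpi_eq; apply: mem_gen; exact: TensorZr.
Qed.

Section TensorLift.
Variables (W : lmodType A) (b : M -> N -> W).

Definition tensor_lift : tensor -> W :=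
  @quot_lift A _ (gen tensor_rel) W (fglift (fun p : M * N => b p.1 p.2)).

Hypothesis bl : forall n, linear (b^~ n).
Hypothesis br : forall m, linear (b m).

Lemma tensor_lift_rel :
  {in gen tensor_rel, forall x, fglift (fun p : M * N => b p.1 p.2) x = 0}.
Proof.
have blD m m' n : b (m + m') n = b m n + b m' n.
  by have := bl n 1 m m'; rewrite !scale1r.
have brD m n n' : b m (n + n') = b m n + b m n'.
  by have := br m 1 n n'; rewrite !scale1r.
have bl0 n : b 0 n = 0 by apply: (addrI (b 0 n)); rewrite -blD !addr0.
have br0 m : b m 0 = 0 by apply: (addrI (b m 0)); rewrite -brD !addr0.
have blZ a m n : b (a *: m) n = a *: b m n.
  by have := bl n a m 0; rewrite !addr0 bl0 addr0.
have brZ a m n : b m (a *: n) = a *: b m n.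
  by have := br m a n 0; rewrite !addr0 br0 addr0.
move=> x xR; apply/eqP.
apply: (gen_min (S := lin_ker (fglift (fun p : M * N => b p.1 p.2))) _ xR).
move=> {xR}_ [m m' n|m n n'|a m n|a m n]; apply/eqP;
  rewrite !raddfB /= ?[X in _ - X = _](linearZ_LR (fglift _)) /=
    !liftU !scale1r /=.
- by rewrite blD -addrA -opprD subrr.
- by rewrite brD -addrA -opprD subrr.
- by rewrite blZ subrr.
- by rewrite brZ subrr.
Qed.

Lemma tensor_liftE m n : tensor_lift (tens m n) = b m n.
Proof.
rewrite /tensor_lift quot_liftE; first by rewrite [LHS]liftU scale1r.
exact: tensor_lift_rel.
Qed.

Lemma tensor_lift_linear : linear tensor_lift.
Proof. exact: quot_lift_linear tensor_lift_rel. Qed.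

End TensorLift.
End Tensor.

Section TensorMap.
Variables (A : comNzRingType) (M M' N N' : lmodType A).
Variables (f : {linear M -> M'}) (g : {linear N -> N'}).

Definition tensor_map : tensor M N -> tensor M' N' :=
  tensor_lift (fun m n => tens (f m) (g n)).

Fact tensor_map_linear : linear tensor_map.
Proof.
apply: tensor_lift_linear => [n a m m'|m a n n'] /=.
  by rewrite linearP tensDl tensZl.
by rewrite linearP tensDr tensZr.
Qed.
HB.instance Definition _ :=
  GRing.isLinear.Build A (tensor M N) (tensor M' N') _ tensor_map
    tensor_map_linear.

Lemma tensor_mapE m n : tensor_map (tens m n) = tens (f m) (g n).
Proof.
apply: tensor_liftE => [{}n a {}m m'|{}m a {}n n'] /=.
  by rewrite linearP tensDl tensZl.
by rewrite linearP tensDr tensZr.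
Qed.

End TensorMap.

Definition flat (A : comNzRingType) (M : lmodType A) : Prop :=
  forall (X Y Z : lmodType A) (f : {linear X -> Y}) (g : {linear Y -> Z}),
    exact_at f g ->
    exact_at (tensor_map (lin_id M) f)
             (tensor_map (lin_id M) g).

(* Tor is the homology of F_* (x) N, where F_* -> M is the standard free      *)
(* resolution: F_n is free on the set of elements of Z_n, with Z_0 = M and    *)
(* Z_(n+1) the kernel of the canonical surjection F_n -> Z_n.                 *)

Section Tor.
Variables (A : comNzRingType).

Definition free_on (M : lmodType A) : lmodType A := {freeg M / A}.

Definition free_aug (M : lmodType A) : {linear free_on M -> M} :=
  fglift (fun m : M => m).

Fixpoint syzygy (M : lmodType A) (n : nat) : lmodType A :=
  if n is n'.+1 then sub_lmod (lin_ker (free_aug (syzygy M n'))) else M.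

Definition res_term (M : lmodType A) n : lmodType A := free_on (syzygy M n).

Definition res_diff (M : lmodType A) n :
    {linear res_term M n.+1 -> res_term M n} :=
  (val : sub_lmod (lin_ker (free_aug (syzygy M n))) -> res_term M n)
    \o free_aug (syzygy M n.+1).

Definition Tor (n : nat) (M N : lmodType A) : lmodType A :=
  let d i := tensor_map (res_diff M i) (lin_id N) in
  if n is n'.+1 then homology (d n'.+1) (d n')
  else homology (d 0%N) (lin_zero _ (tensor (res_term M 0) N)).

End Tor.

Definition restrict_scalars (A B : comNzRingType) (phi : {rmorphism A -> B})
  (Y : lmodType B) : Type := Y.

Section RestrictScalars.
Variables (A B : comNzRingType) (phi : {rmorphism A -> B}) (Y : lmodType B).
Local Notation rY := (restrict_scalars phi Y).

HB.instance Definition _ := GRing.Zmodule.copy rY Y.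

Definition rscale (a : A) (y : rY) : rY := phi a *: (y : Y).

Fact rscaleA a b y : rscale a (rscale b y) = rscale (a * b) y.
Proof. by rewrite /rscale scalerA rmorphM. Qed.
Fact rscale1 : left_id 1 rscale.
Proof. by move=> y; rewrite /rscale rmorph1 scale1r. Qed.
Fact rscaleDr : right_distributive rscale +%R.
Proof. by move=> a x y; rewrite /rscale scalerDr. Qed.
Fact rscaleDl y : {morph rscale^~ y : a b / a + b}.
Proof. by move=> a b; rewrite /rscale rmorphD scalerDl. Qed.

HB.instance Definition _ := GRing.Zmodule_isLmodule.Build A rY
  rscaleA rscale1 rscaleDr rscaleDl.

End RestrictScalars.

Definition finitely_generated (A : comNzRingType) (M : lmodType A) : Prop :=
  exists s : seq M, forall y, y \in gen (fun x => x \in s).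

Definition noetherian (A : comNzRingType) : Prop :=
  forall I : ideal A, exists s : seq A^o, I =i gen (fun x => x \in s).

Definition maximal_ideal (A : comNzRingType) (I : ideal A) : Prop :=
  1 \notin I /\
  forall J : ideal A, {subset I <= J} -> 1 \notin J -> J =i I.

Definition local_ring (A : comNzRingType) (m : ideal A) : Prop :=
  maximal_ideal m /\ forall I : ideal A, maximal_ideal I -> I =i m.

Definition local_morphism (A B : comNzRingType) (mA : ideal A) (mB : ideal B)
    (phi : {rmorphism A -> B}) : Prop :=
  forall a, a \in mA -> phi a \in mB.

Definition residue_module (A : comNzRingType) (m : ideal A) : lmodType A :=
  quot_lmod m.

(* Main.v *)
Require Import Defs.
From HB Require Import structures.
From mathcomp Require Import all_boot all_algebra.
From mathcomp Require Import boolp.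
From mathcomp.multinomials Require Import freeg.

Import GRing.Theory.
Local Open Scope ring_scope.

Set Implicit Arguments.
Unset Strict Implicit.
Unset Printing Implicit Defensive.

(** Everything is reduced to the equational form of flatness: M is flat over A
    as soon as every relation sum_i a_i y_i = 0 (a_i in A, y_i in M) is trivial,
    that is, y_i = sum_j r_ji z_j with sum_i r_ji a_i = 0 for all j.  For a
    given family a, the obstruction is the module of relations modulo the
    trivial ones, which is Tor_1(M, A/(a)).

    If Tor_1(Y, A/mA) = 0, relations over generators of mA are trivial
    ([Tor1_residue_relations_trivial]).  This propagates to all ideals I by
    noetherian induction ([relations_trivial_of_maximal]).  If I is neither A
    nor mA, maximality of mA gives c in mA outside I.  The sequence
    0 -> A/(I:c) -> A/I -> A/(I + cA) -> 0 and the induction hypothesis for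
    I + cA show that the obstruction of I is a quotient of that of (I:c); its
    elementary form is [colon_reduction].  If (I:c) is
    larger than I, induction applies again.  If (I:c) = I, multiplication by c
    is onto on the obstruction of I; that obstruction is a B-module, finitely
    generated because Y is and B is noetherian, and c acts through the maximal
    ideal of B, so it vanishes by Nakayama's lemma
    ([relations_trivial_of_regular]).  This is the only place where B enters.

    Trivial relations give flatness ([flat_of_relations_trivial]): systems of
    equations with coefficients in A reduce to single equations one at a time,
    and the vanishing of an element of M (x) Z becomes such a system once Z is
    covered by a free module.

    The converse, that flat modules have no Tor_1, is a chase between free
    presentations of the two arguments ([syzygy_tensor_inj]).  It rests on
    the right exactness of the tensor product, and on the fact that an element
    of M (x) P with P free is determined by its coordinates in M. *)

(** * Submodules and generators *)

Section PredicateSubmodule.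
Variables (A : comNzRingType) (V : lmodType A) (P : V -> Prop).
Hypothesis P0 : P 0.
Hypothesis PL : forall a u v, P u -> P v -> P (a *: u + v).

(** The closure proofs are arguments of the predicate so that the structure
    instance below can be found from the term alone. *)
Definition submod_pred of P 0 & (forall a u v, P u -> P v -> P (a *: u + v)) :
  {pred V} := fun v => `[< P v >].

Fact submod_pred_closed : submod_closed (submod_pred P0 PL).
Proof.
split=> [|a u v /asboolP Pu /asboolP Pv]; apply/asboolP; first exact: P0.
exact: PL.
Qed.
HB.instance Definition _ :=
  GRing.isSubmodClosed.Build A V (submod_pred P0 PL) submod_pred_closed.

Definition submod_of : submodClosed V := submod_pred P0 PL.

Lemma submod_ofP x : x \in submod_of <-> P x.
Proof. by split=> [/asboolP|Px] //; apply/asboolP. Qed.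

End PredicateSubmodule.

Lemma submodB (A : comNzRingType) (V : lmodType A) (S : submodClosed V) u v :
  u \in S -> v \in S -> u - v \in S.
Proof. exact: (submod_zmod_closed S).2. Qed.

Lemma gen_ind (A : comNzRingType) (V : lmodType A) (P Q : V -> Prop) :
  Q 0 -> (forall a u v, Q u -> Q v -> Q (a *: u + v)) ->
  (forall x, P x -> Q x) -> forall x, x \in gen P -> Q x.
Proof.
move=> Q0 QL PQ x /(gen_min (S := submod_of Q0 QL)) xQ.
by apply/(submod_ofP Q0 QL)/xQ => y /PQ Qy; apply/submod_ofP.
Qed.

Section Span.
Variables (A : comNzRingType) (V : lmodType A).
Implicit Types (s t : seq V) (x v w : V).

Lemma span_sub s (S : submodClosed V) :
  {subset s <= S} -> {subset gen (fun x => x \in s) <= S}.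
Proof. by move=> sS; apply: gen_min => x /sS. Qed.

Lemma span_mono s t :
  {subset s <= t} -> {subset gen (fun x => x \in s) <= gen (fun x => x \in t)}.
Proof. by move=> st; apply: span_sub => x /st xt; apply: mem_gen. Qed.

Lemma span_cons v s x :
  x \in gen (fun x => x \in v :: s) <->
  exists b w, w \in gen (fun x => x \in s) /\ x = b *: v + w.
Proof.
split=> [|[b [w [ws ->]]]]; last first.
  rewrite rpredD ?rpredZ //; first by apply: mem_gen; rewrite mem_head.
  by apply: span_mono ws => y ys; rewrite in_cons ys orbT.
move: x; apply: gen_ind => [|a _ _ [b [w [ws ->]]] [b' [w' [ws' ->]]]|x].
- by exists 0, 0; rewrite rpred0 scale0r addr0.
- exists (a * b + b'), (a *: w + w'); rewrite rpredD ?rpredZ //; split=> //.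
  by rewrite scalerDr scalerDl scalerA addrACA.
rewrite in_cons => /orP[/eqP->|xs]; last first.
  by exists 0, x; rewrite scale0r add0r; split=> //; apply: mem_gen.
by exists 1, 0; rewrite rpred0 scale1r addr0.
Qed.

Lemma span_nil x : x \in gen (fun x => x \in [::]) -> x = 0.
Proof.
move: x; apply: gen_ind => [|a _ _ -> ->|x] //; first by rewrite scaler0 addr0.
Qed.

Lemma span_coef s x : x \in gen (fun x => x \in s) ->
  exists r : 'I_(size s) -> A, x = \sum_i r i *: s`_i.
Proof.
move: x; apply: gen_ind => [|a _ _ [r ->] [r' ->]|x xs].
- by exists (fun=> 0); rewrite big1 // => i _; rewrite scale0r.
- exists (fun i => a * r i + r' i); rewrite scaler_sumr -big_split /=.
  by apply: eq_bigr => i _; rewrite scalerDl scalerA.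
have ix : (index x s < size s)%N by rewrite index_mem.
exists (fun i => (i == Ordinal ix)%:R); rewrite (bigD1 (Ordinal ix)) //=.
rewrite eqxx scale1r nth_index // big1 ?addr0 // => i /negPf->.
by rewrite scale0r.
Qed.

End Span.

(** * Noetherian rings *)

Section Noetherian.
Variables (A : comNzRingType) (noethA : noetherian A).

(** The union of the chain is an ideal, and finitely many generators already
    lie in one term. *)
Lemma noetherian_chain (I : nat -> ideal A) :
  (forall n, {subset I n <= I n.+1}) -> exists n, {subset I n.+1 <= I n}.
Proof.
move=> Iinc.
have Imono m n : (m <= n)%N -> {subset I m <= I n}.
  move=> /subnK<-; elim: (n - m)%N => [|k IHk] x // /IHk.
  exact: Iinc.
have U0 : exists n, (0 : A^o) \in I n by exists 0%N; rewrite rpred0.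
have UL (a : A) (u v : A^o) : (exists n, u \in I n) -> (exists n, v \in I n) ->
    exists n, a *: u + v \in I n.
  move=> [m um] [n vn]; exists (maxn m n).
  by rewrite rpredD ?rpredZ // (Imono _ _ _ _ um, Imono _ _ _ _ vn)
    ?leq_maxl ?leq_maxr.
have [s sE] := noethA (submod_of U0 UL).
have [N sN] : exists N, {subset s <= I N}.
  have : {subset s <= submod_of U0 UL} by move=> x xs; rewrite sE mem_gen.
  elim: s {sE} => [|x s IHs] sU; first by exists 0%N.
  have [|n sn] := IHs; first by move=> y ys; apply: sU; rewrite in_cons ys orbT.
  have [m xm] := (submod_ofP U0 UL x).1 (sU x (mem_head _ _)).
  exists (maxn m n) => y; rewrite in_cons => /orP[/eqP->|/sn].
    by apply: Imono xm; rewrite leq_maxl.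
  by apply: Imono; rewrite leq_maxr.
exists N => x xN; apply: (span_sub sN); rewrite -sE.
by apply/submod_ofP; exists N.+1.
Qed.

(** Were there an ideal without [P], each such ideal would lie strictly inside
    another, and dependent choice would build a strictly increasing chain. *)
Lemma noetherian_ind (P : ideal A -> Prop) :
  (forall I : ideal A,
    (forall J : ideal A, {subset I <= J} -> ~ {subset J <= I} -> P J) -> P I) ->
  forall I, P I.
Proof.
move=> IH I0; apply: contrapT => nPI0.
have next (I : {I | ~ P I}) : {J : {J | ~ P J} |
    {subset sval I <= sval J} /\ ~ {subset sval J <= sval I}}.
  apply: cid; case: I => I nPI /=; apply: contrapT => noJ.
  apply: nPI; apply: IH => J IJ JI; apply: contrapT => nPJ; apply: noJ.
  by exists (exist _ J nPJ).
pose chain n := iter n (fun I => sval (next I)) (exist _ I0 nPI0).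
have chainP n := svalP (next (chain n)).
have [n|n nI] := @noetherian_chain (fun n => sval (chain n)).
  by case: (chainP n).
by case: (chainP n) => _; apply.
Qed.

Lemma proper_sub_maximal (I : ideal A) :
  1 \notin I -> exists J : ideal A, maximal_ideal J /\ {subset I <= J}.
Proof.
move: I; apply: noetherian_ind => I IH I1.
have [Imax|] := pselect (maximal_ideal I); first by exists I; split.
move=> nImax; apply: contrapT => noJ; apply: nImax; split=> // J IJ J1.
have [JI x|nJI] := pselect {subset J <= I}.
  by apply/idP/idP => [/JI|/IJ].
have [K [Kmax JK]] := IH J IJ nJI J1.
by case: noJ; exists K; split=> // x /IJ/JK.
Qed.

(** Splitting off the first generator: the coefficients it gets in elements of
    the submodule form an ideal, and what is left is a submodule of the span of
    the other generators. *)
Lemma noetherian_submodule (V : lmodType A) (s : seq V) (R : submodClosed V) :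
  {subset R <= gen (fun x => x \in s)} ->
  exists t : seq V, R =i gen (fun x => x \in t).
Proof.
elim: s R => [|v s IHs] R Rs.
  exists [::] => x; apply/idP/idP => [/Rs //|/span_nil->].
  exact: rpred0.
pose c (b : A^o) := exists2 w, w \in gen (fun x => x \in s) & b *: v + w \in R.
have c0 : c 0 by exists 0; rewrite ?rpred0 // scale0r addr0 rpred0.
have cL (a : A) (b b' : A^o) : c b -> c b' -> c (a *: b + b').
  move=> [w ws bR] [w' ws' bR']; exists (a *: w + w').
    by rewrite rpredD ?rpredZ.
  rewrite scalerDl -[(_ *: b) *: v]scalerA addrACA -scalerDr.
  by rewrite rpredD ?rpredZ.
have [l lE] := noethA (submod_of c0 cL).
have R'0 : (0 : V) \in gen (fun x => x \in s) /\ 0 \in R.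
  by split; apply: rpred0.
have R'L a u w : u \in gen (fun x => x \in s) /\ u \in R ->
    w \in gen (fun x => x \in s) /\ w \in R ->
    a *: u + w \in gen (fun x => x \in s) /\ a *: u + w \in R.
  by move=> [? ?] [? ?]; rewrite !rpredD ?rpredZ.
have [t tE] := IHs (submod_of R'0 R'L) (fun x h => ((submod_ofP _ _ x).1 h).1).
(* t' lifts to R the generators of the ideal of coefficients of v *)
have [t' [t'R t'l]] : exists t' : seq V, {subset t' <= R} /\
    forall b, b \in gen (fun x => x \in l) -> exists2 w,
      w \in gen (fun x => x \in s) & b *: v + w \in gen (fun x => x \in t').
  have : {subset l <= submod_of c0 cL} by move=> x xs; rewrite lE mem_gen.
  elim: l {lE} => [|b l IHl] lc.
    exists [::]; split=> // b /span_nil->; exists 0; first exact: rpred0.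
    by rewrite scale0r addr0; apply: rpred0.
  have [|t' [t'R t'l]] := IHl.
    by move=> y yl; apply: lc; rewrite in_cons yl orbT.
  have [w ws bR] := (submod_ofP c0 cL b).1 (lc b (mem_head _ _)).
  exists (b *: v + w :: t'); split=> [x|x].
    by rewrite in_cons => /orP[/eqP->|/t'R].
  move=> /span_cons[d [e [/t'l[w' ws' eR] ->]]].
  exists (d *: w + w'); first by rewrite rpredD ?rpredZ.
  apply/span_cons; exists d, (e *: v + w'); split=> //.
  by rewrite scalerDl scalerDr scalerA addrACA.
exists (t' ++ t) => x; apply/idP/idP => [xR|]; last first.
  apply: span_sub => y; rewrite mem_cat => /orP[/t'R //|yt].
  by have /submod_ofP[] : y \in submod_of R'0 R'L by rewrite tE mem_gen.
have /span_cons[b [w [ws xE]]] := Rs x xR.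
have bl : b \in gen (fun x => x \in l).
  by rewrite -lE; apply/submod_ofP; exists w; rewrite -?xE.
have [w' ws' bt'] := t'l b bl.
have ww : w - w' \in submod_of R'0 R'L.
  apply/submod_ofP; split; first exact: submodB.
  have -> : w - w' = x - (b *: v + w') by rewrite xE opprD addrACA subrr add0r.
  exact: submodB xR (span_sub t'R bt').
have -> : x = (b *: v + w') + (w - w') by rewrite xE addrA addrAC addrK.
apply: rpredD; first by apply: span_mono bt' => y yt; rewrite mem_cat yt.
by move: ww; rewrite tE; apply: span_mono => y yt; rewrite mem_cat yt orbT.
Qed.

End Noetherian.

Section Local.
Variables (B : comNzRingType) (m : ideal B).
Hypotheses (noethB : noetherian B) (localB : local_ring m).

(** Otherwise the ideal generated by [1 - x] would lie in the maximal ideal,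
    which would then contain 1. *)
Lemma local_unit (x : B) : x \in m -> exists u, u * (1 - x) = 1.
Proof.
move=> xm; apply: contrapT => nu.
have P0 : exists u, (0 : B^o) = u * (1 - x) by exists 0; rewrite mul0r.
have PL (a : B) (y z : B^o) : (exists u, y = u * (1 - x)) ->
    (exists u, z = u * (1 - x)) -> exists u, a *: y + z = u * (1 - x).
  by move=> [u ->] [u' ->]; exists (a * u + u'); rewrite mulrDl -mulrA.
have [|J [Jmax IJ]] := proper_sub_maximal noethB (I := submod_of P0 PL).
  by apply/negP => /submod_ofP[u u1]; apply: nu; exists u.
have : 1 - x \in J by apply: IJ; apply/submod_ofP; exists 1; rewrite mul1r.
move: Jmax.1; rewrite !(localB.2 J Jmax) => /negP + hx; apply.
by rewrite -(subrK x 1) rpredD.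
Qed.

(** Nakayama's lemma for the quotient of the span of [s] by [S], eliminating one
    generator at a time. *)
Lemma nakayama (V : lmodType B) (s : seq V) (S : submodClosed V) (c : B) :
    c \in m ->
    (forall x, x \in s -> exists y w,
       [/\ y \in S, w \in gen (fun x => x \in s) & x = y + c *: w]) ->
  {subset gen (fun x => x \in s) <= S}.
Proof.
move=> cm hs; apply: span_sub; elim: s hs => [|v s IHs] hs //.
have [y0 [w0 [y0S /span_cons[b [w [ws ->]]] vE]]] := hs v (mem_head _ _).
have [|u uE] := @local_unit (c * b).
  by rewrite mulrC; have := @rpredZ _ _ m b _ cm.
have {}vE : v = u *: y0 + (u * c) *: w.
  (* 1 - c * b is invertible, so v is eliminated *)
  have cE : (1 - c * b) *: v = y0 + c *: w.
    apply/eqP; rewrite scalerBl scale1r subr_eq {1}vE scalerDr scalerA.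
    by rewrite [_ + c *: w]addrC addrA.
  by rewrite -[LHS]scale1r -uE -[LHS]scalerA cE scalerDr scalerA.
have sS : {subset s <= S}.
  apply: IHs => x xs.
  have [|y [_ [yS /span_cons[d [w' [ws' ->]]] xE]]] := hs x.
    by rewrite in_cons xs orbT.
  exists (y + (c * d * u) *: y0), ((d * u * c) *: w + w'); split.
  - by rewrite rpredD ?rpredZ.
  - by rewrite rpredD ?rpredZ.
  rewrite xE vE !scalerDr !scalerA -!addrA; congr (_ + _).
  by rewrite !mulrA.
move=> x; rewrite in_cons => /orP[/eqP->|/sS //].
by rewrite vE rpredD ?rpredZ // (span_sub sS).
Qed.

End Local.

(** * Trivial relations *)

Section TrivialRelations.
Variables (A : comNzRingType) (M : lmodType A).

(** A family [y] that is a combination, with coefficients [z] in the module, of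
    syzygies of [a] over the ring itself.  Any finite type may index the
    syzygies, so that sums of trivial relations are indexed by disjoint
    unions. *)
Definition trivial_relation (I : finType) (a : I -> A) (y : I -> M) : Prop :=
  exists (J : finType) (r : J -> I -> A) (z : J -> M),
    (forall j, \sum_i r j i * a i = 0) /\
    (forall i, y i = \sum_j r j i *: z j).

(** Equivalent to the vanishing of Tor_1(M, A/(a)). *)
Definition relations_trivial (I : finType) (a : I -> A) : Prop :=
  forall y : I -> M, \sum_i a i *: y i = 0 -> trivial_relation a y.

Definition combination (I : finType) (a : I -> A) (x : A) : Prop :=
  exists r : I -> A, x = \sum_i r i * a i.

Section Closure.
Variables (I : finType) (a : I -> A).

Lemma trivial_relation0 : trivial_relation a (fun=> 0).
Proof.
exists void, (fun _ _ => 0), (fun=> 0).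
by split=> [[]|i]; rewrite big1 // => -[].
Qed.

Lemma trivial_relationD (y y' : I -> M) :
  trivial_relation a y -> trivial_relation a y' ->
  trivial_relation a (fun i => y i + y' i).
Proof.
move=> [J [r [z [ra yE]]]] [J' [r' [z' [ra' yE']]]].
exists (J + J')%type.
exists (fun j => match j with inl j => r j | inr j => r' j end).
exists (fun j => match j with inl j => z j | inr j => z' j end).
by split=> [[j|j] //|i]; rewrite big_sumType /= yE yE'.
Qed.

Lemma eq_trivial_relation (y y' : I -> M) :
  y =1 y' -> trivial_relation a y -> trivial_relation a y'.
Proof.
move=> yy' [J [r [z [ra yE]]]]; exists J, r, z.
by split=> // i; rewrite -yy' yE.
Qed.

(** Multiplication by [c] sends (b) into (a); the matrix [d] lifts it to the
    families of generators, hence sends syzygies of [b] to syzygies of [a]. *)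
Lemma trivial_relation_map (K : finType) (b : K -> A) (c : A) (d : K -> I -> A)
    (v : K -> M) :
  (forall k, \sum_i d k i * a i = b k * c) ->
  trivial_relation b v -> trivial_relation a (fun i => \sum_k d k i *: v k).
Proof.
move=> dE [J [r [z [rb vE]]]].
exists J, (fun j i => \sum_k r j k * d k i), z; split=> [j|i].
  under eq_bigr do rewrite mulr_suml.
  rewrite exchange_big /=.
  under eq_bigr do under eq_bigr do rewrite -mulrA.
  under eq_bigr do rewrite -mulr_sumr dE mulrA.
  by rewrite -mulr_suml rb mul0r.
under eq_bigr do rewrite vE scaler_sumr.
rewrite exchange_big /=; apply: eq_bigr => j _.
rewrite scaler_suml; apply: eq_bigr => k _.
by rewrite scalerA mulrC.
Qed.

Lemma trivial_relationN (y : I -> M) :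
  trivial_relation a y -> trivial_relation a (fun i => - y i).
Proof.
move=> [J [r [z [ra yE]]]]; exists J, r, (fun j => - z j); split=> // i.
by rewrite yE -sumrN; apply: eq_bigr => j _; rewrite scalerN.
Qed.

(** If [1 = sum_i e_i a_i], the vectors [delta_k - a_k e] are syzygies of [a],
    and a relation [y] is their combination with coefficients [y_k]. *)
Lemma relations_trivial_unit : combination a 1 -> relations_trivial a.
Proof.
move=> [e e1] y ya.
exists I, (fun k i => (i == k)%:R - a k * e i), y; split=> [k|i].
  under eq_bigr do rewrite mulrBl -mulrA.
  rewrite sumrB -mulr_sumr -e1 mulr1 (bigD1 k) //= eqxx mul1r big1 ?addr0.
    by rewrite subrr.
  by move=> i /negPf->; rewrite mul0r.
under eq_bigr do rewrite scalerBl mulrC -scalerA.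
rewrite sumrB -scaler_sumr ya scaler0 subr0 (bigD1 i) //= eqxx scale1r.
by rewrite big1 ?addr0 // => k; rewrite eq_sym => /negPf->; rewrite scale0r.
Qed.

(** Adjoin [c] to [a] and write [(y, 0)] as a combination of syzygies of
    [(a, c)].  Their last coordinates lie in the colon ideal, generated by [b],
    so each of them can be traded for coordinates along [a]. *)
Lemma colon_reduction (K : finType) (b : K -> A) (c : A) (d : K -> I -> A)
    (y : I -> M) :
  relations_trivial (fun i : I + unit => if i is inl i then a i else c) ->
  (forall x, combination a (x * c) -> combination b x) ->
  (forall k, \sum_i d k i * a i = b k * c) ->
  \sum_i a i *: y i = 0 ->
  exists v, \sum_k b k *: v k = 0 /\
    trivial_relation a (fun i => y i + \sum_k d k i *: v k).
Proof.
move=> acT colon dE ya.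
have [|J [r [z [rac yE]]]] :=
    acT (fun i : I + unit => if i is inl i then y i else 0).
  by rewrite big_sumType /= ya add0r big1 // => i _; rewrite scaler0.
have racE j : \sum_i r j (inl i) * a i = - r j (inr tt) * c.
  move: (rac j); rewrite big_sumType /= (big_pred1 tt) => [/eqP|[]//].
  by rewrite addr_eq0 mulNr => /eqP.
have /choice[t tE] j : exists t : K -> A, r j (inr tt) = \sum_k t k * b k.
  apply: colon; exists (fun i => - r j (inl i)).
  under eq_bigr do rewrite mulNr.
  by rewrite sumrN racE mulNr opprK.
exists (fun k => \sum_j t j k *: z j); split.
  under eq_bigr do rewrite scaler_sumr.
  rewrite exchange_big /= [RHS](yE (inr tt)); apply: eq_bigr => j _.
  rewrite tE scaler_suml; apply: eq_bigr => k _.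
  by rewrite scalerA mulrC.
exists J, (fun j i => r j (inl i) + \sum_k t j k * d k i), z; split=> [j|i].
  under eq_bigr do rewrite mulrDl mulr_suml.
  rewrite big_split /= racE exchange_big /=.
  under [X in _ + X]eq_bigr do under eq_bigr do rewrite -mulrA.
  under [X in _ + X]eq_bigr do rewrite -mulr_sumr dE mulrA.
  by rewrite -mulr_suml -tE mulNr addNr.
rewrite (yE (inl i)); under [RHS]eq_bigr do rewrite scalerDl.
rewrite big_split /=; congr (_ + _).
under eq_bigr do rewrite scaler_sumr.
rewrite exchange_big /=; apply: eq_bigr => j _.
by rewrite scaler_suml; apply: eq_bigr => k _; rewrite scalerA mulrC.
Qed.

End Closure.

Lemma ideal_family (I : ideal A) : noetherian A ->
  exists (T : finType) (a : T -> A), forall x, x \in I <-> combination a x.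
Proof.
move=> /(_ I)[s sE]; exists 'I_(size s), (fun i : 'I_(size s) => s`_i) => x.
rewrite sE; split=> [/span_coef //|[r ->]].
apply: rpred_sum => i _; apply: (rpredZ (r i)).
by apply: mem_gen; rewrite mem_nth.
Qed.

Lemma combination0 (I : finType) (a : I -> A) : combination a (0 : A^o).
Proof. by exists (fun=> 0); rewrite big1 // => i _; rewrite mul0r. Qed.

Lemma combinationL (I : finType) (a : I -> A) (e : A) (x x' : A^o) :
  combination a x -> combination a x' -> combination a (e *: x + x').
Proof.
move=> [r ->] [r' ->]; exists (fun i => e * r i + r' i).
rewrite scaler_sumr -big_split /=; apply: eq_bigr => i _.
by rewrite mulrDl -mulrA.
Qed.

Definition family_ideal (I : finType) (a : I -> A) : ideal A :=
  submod_of (combination0 a) (combinationL (a := a)).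

Lemma family_idealP (I : finType) (a : I -> A) x :
  x \in family_ideal a <-> combination a x.
Proof. exact: submod_ofP. Qed.

Lemma combination_mem (I : finType) (a : I -> A) i : combination a (a i).
Proof.
exists (fun k => (k == i)%:R); rewrite (bigD1 i) //= eqxx mul1r.
by rewrite big1 ?addr0 // => k /negPf->; rewrite mul0r.
Qed.

End TrivialRelations.

(** * The noetherian induction *)

Lemma finitely_generated_ffun (B : comNzRingType) (Y : lmodType B)
    (I : finType) :
  finitely_generated Y -> finitely_generated {ffun I -> Y}.
Proof.
move=> [s sY]; pose single i (y : Y) : {ffun I -> Y} :=
  [ffun k => if k == i then y else 0].
exists [seq single i y | i <- enum I, y <- s] => f.
have -> : f = \sum_i single i (f i).
  apply/ffunP => k; rewrite sum_ffunE (bigD1 k) //= ffunE eqxx big1 ?addr0 //.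
  by move=> i; rewrite ffunE eq_sym => /negPf->.
apply: rpred_sum => i _; move: (f i) (sY (f i)); apply: gen_ind.
- have -> : single i 0 = 0 by apply/ffunP => k; rewrite !ffunE if_same.
  exact: rpred0.
- move=> b u v us vs.
  have -> : single i (b *: u + v) = b *: single i u + single i v.
    by apply/ffunP => k; rewrite !ffunE; case: ifP; rewrite // scaler0 addr0.
  by rewrite rpredD ?rpredZ.
by move=> y ys; apply: mem_gen; apply: allpairs_f; rewrite ?mem_enum.
Qed.

Section LocalCriterion.
Variables (A B : comNzRingType) (mA : ideal A) (mB : ideal B).
Variables (phi : {rmorphism A -> B}) (Y : lmodType B).
Hypotheses (noethA : noetherian A) (noethB : noetherian B).
Hypotheses (localA : local_ring mA) (localB : local_ring mB).
Hypothesis phi_local : local_morphism mA mB phi.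
Hypothesis Y_fg : finitely_generated Y.
Local Notation rY := (restrict_scalars phi Y).

(** The hypothesis says that [c] acts surjectively on relations modulo trivial
    relations.  Both are B-submodules of the finite power of [Y], the first one
    finitely generated, so Nakayama's lemma over [B] applies. *)
Lemma relations_trivial_of_regular (I : finType) (a : I -> A) (c : A) :
  c \in mA ->
  (forall y : I -> rY, \sum_i a i *: y i = 0 ->
     exists v : I -> rY, \sum_i a i *: v i = 0 /\
       trivial_relation a (fun i => y i + c *: v i)) ->
  relations_trivial rY a.
Proof.
move=> cm hc.
pose R (y : {ffun I -> Y}) := \sum_i phi (a i) *: y i = 0.
(* The two scalings are convertible; sums are manipulated over B. *)
have RE (y : I -> rY) :
  \sum_i a i *: y i = 0 <-> \sum_i phi (a i) *: (y i : Y) = 0.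
  by [].
have R0 : R 0 by rewrite /R big1 // => i _; rewrite ffunE scaler0.
have RL (b : B) u v : R u -> R v -> R (b *: u + v).
  move=> Ru Rv; transitivity (b *: (\sum_i phi (a i) *: u i) +
    \sum_i phi (a i) *: v i); last by rewrite Ru Rv scaler0 addr0.
  rewrite scaler_sumr -big_split /=; apply: eq_bigr => i _.
  by rewrite !ffunE scalerDr !scalerA mulrC.
pose S (y : {ffun I -> Y}) := trivial_relation a (fun i => y i : rY).
have S0 : S 0.
  by apply: eq_trivial_relation (trivial_relation0 _ a) => i; rewrite ffunE.
have SL (b : B) u v : S u -> S v -> S (b *: u + v).
  move=> [J [r [z [ra uE]]]] Sv.
  apply: (@eq_trivial_relation _ _ _ _ (fun i => (b *: u i : rY) + (v i : rY))).
    by move=> i; rewrite !ffunE.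
  apply: trivial_relationD => //.
  exists J, r, (fun j => (b *: (z j : Y)) : rY); split=> // i.
  have {}uE : u i = \sum_j phi (r j i) *: (z j : Y) by exact: uE.
  rewrite uE scaler_sumr; change (\sum_j b *: (phi (r j i) *: (z j : Y)) =
    \sum_j phi (r j i) *: (b *: (z j : Y))).
  by apply: eq_bigr => j _; rewrite !scalerA mulrC.
have [s sY] := @finitely_generated_ffun B Y I Y_fg.
have [t tE] := noetherian_submodule noethB (R := submod_of R0 RL)
  (fun x _ => sY x).
have tS : {subset gen (fun x => x \in t) <= submod_of S0 SL}.
  apply: (nakayama noethB localB (phi_local cm)) => y yt.
  have /submod_ofP Ry : y \in submod_of R0 RL by rewrite tE mem_gen.
  have [v [/RE va yv]] := hc _ (iffRL (RE _) Ry).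
  exists [ffun i => y i + phi c *: (v i : Y)], [ffun i => - (v i : Y)]; split.
  - by apply/submod_ofP; apply: eq_trivial_relation yv => i; rewrite ffunE.
  - rewrite -tE; apply/submod_ofP.
    transitivity (- \sum_i phi (a i) *: (v i : Y)); last by rewrite va oppr0.
    by rewrite -sumrN; apply: eq_bigr => i _; rewrite ffunE scalerN.
  by apply/ffunP => i; rewrite !ffunE scalerN addrK.
move=> y /RE ya; have yt : [ffun i => y i : Y] \in gen (fun x => x \in t).
  rewrite -tE; apply/submod_ofP.
  transitivity (\sum_i phi (a i) *: (y i : Y)) => //.
  by apply: eq_bigr => i _; rewrite ffunE.
have /submod_ofP := tS _ yt.
by apply: eq_trivial_relation => i; rewrite ffunE.
Qed.

(** Noetherian induction on the ideal generated by [a], through an element [c]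
    of the maximal ideal outside it and the colon ideal of [c]. *)
Lemma relations_trivial_of_maximal :
  (forall (I : finType) (a : I -> A),
     (forall x, x \in mA <-> combination a x) -> relations_trivial rY a) ->
  forall (I : finType) (a : I -> A), relations_trivial rY a.
Proof.
move=> mT; suff H (J : ideal A) : forall (I : finType) (a : I -> A),
    (forall x, x \in J <-> combination a x) -> relations_trivial rY a.
  by move=> I a; apply: (H (family_ideal a)) => x; apply: family_idealP.
move: J; apply: (noetherian_ind noethA) => J IH I a aJ.
have [J1|J1] := boolP (1 \in J).
  by apply: relations_trivial_unit; apply/aJ.
have [mJ|] := pselect {subset mA <= J}.
  by apply: mT => x; rewrite -(localA.1.2 J mJ J1) -aJ.
move=> /existsNP[c /not_implyP[cm cJ]].
pose ac (i : I + unit) := if i is inl i then a i else c.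
have acT : relations_trivial rY ac.
  apply: (IH (family_ideal ac)); last by move=> x; apply: family_idealP.
    move=> x xJ; apply/family_idealP; have [r ->] := (aJ x).1 xJ.
    exists (fun i => if i is inl i then r i else 0).
    by rewrite big_sumType /= [X in _ + X]big1 ?addr0 // => i _; rewrite mul0r.
  by move=> Jac; apply/cJ/Jac/family_idealP/(combination_mem ac (inr tt)).
have C0 : combination a ((0 : A^o) * c) by rewrite mul0r; apply: combination0.
have CL (e : A) (x x' : A^o) :
    combination a (x * c) -> combination a (x' * c) ->
    combination a ((e *: x + x') * c).
  move=> hx hx'; rewrite mulrDl -mulrA.
  exact: (combinationL e hx hx').
pose Jc : ideal A := submod_of C0 CL.
have JJc : {subset J <= Jc}.
  move=> x xJ; apply/submod_ofP/aJ; rewrite mulrC.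
  by have := rpredZ c xJ.
(* If J : c = J, the same family generates both ideals, and multiplication by
   c is lifted by the scalar matrix c. *)
have [JcJ|JcJ] := pselect {subset Jc <= J}.
  apply: (relations_trivial_of_regular cm) => y ya.
  have [||v [va yv]] := colon_reduction (b := a)
      (d := fun k i => (k == i)%:R * c) acT _ _ ya.
  - by move=> x xc; apply/aJ/JcJ/submod_ofP.
  - move=> k; rewrite (bigD1 k) //= eqxx mul1r big1 ?addr0 1?mulrC //.
    by move=> i; rewrite eq_sym => /negPf->; rewrite !mul0r.
  exists v; split=> //; apply: eq_trivial_relation yv => i.
  congr (_ + _); rewrite (bigD1 i) //= eqxx mul1r big1 ?addr0 //.
  by move=> k /negPf->; rewrite mul0r scale0r.
have [K [b bE]] := ideal_family Jc noethA.
have /choice[d dE] k : exists d : I -> A, \sum_i d i * a i = b k * c.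
  have /(submod_ofP C0 CL)[d ->] : b k \in Jc; last by exists d.
  by apply/bE; apply: combination_mem.
move=> y ya; have [|v [vb yv]] := colon_reduction (b := b) acT _ dE ya.
  by move=> x xc; apply/bE/submod_ofP.
have vT := IH Jc JJc JcJ K b bE v vb.
have := trivial_relationD yv (trivial_relationN (trivial_relation_map dE vT)).
by apply: eq_trivial_relation => i; rewrite addrK.
Qed.

End LocalCriterion.

(** * Tensor products *)

Lemma freegU_scale (A : comNzRingType) (K : choiceType) (c : A) (x : K) :
  << c *g x >> = c *: << x >> :> {freeg K / A}.
Proof. by apply/eqP/freeg_eqP => k; rewrite coeffZ !coeffU mul1r. Qed.

Lemma freeg_sum_sub (A : comNzRingType) (K : choiceType) (x : {freeg K / A})
    (E : seq K) : uniq E -> {subset dom x <= E} ->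
  x = \sum_(n <- E) coeff n x *: << n >>.
Proof.
move=> Eu xE; apply/eqP/freeg_eqP => k; rewrite [RHS]raddf_sum /=.
  under eq_bigr do rewrite coeffZ coeffU mul1r.
  have [kE|kE] := boolP (k \in E).
    rewrite (bigD1_seq k) //= eqxx mulr1 big1 ?addr0 // => n /negPf->.
    by rewrite mulr0.
  rewrite coeff_outdom; last by apply: contra kE; apply: xE.
  rewrite big_seq big1 // => n nE; case: eqP => [nk|]; last by rewrite mulr0.
  by rewrite -nk nE in kE.
Qed.

Section TensorElements.
Variables (A : comNzRingType) (M N : lmodType A).

Lemma tens0r (m : M) : tens m (0 : N) = 0.
Proof. by rewrite -(scale0r 0) tensZr scale0r. Qed.

Lemma tens0l (n : N) : tens (0 : M) n = 0.
Proof. by rewrite -(scale0r 0) tensZl scale0r. Qed.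

Lemma tens_sumr (I : finType) (m : M) (n : I -> N) :
  tens m (\sum_i n i) = \sum_i tens m (n i).
Proof. exact: (big_morph _ (tensDr m) (tens0r m)). Qed.

Lemma tens_suml (I : finType) (m : I -> M) (n : N) :
  tens (\sum_i m i) n = \sum_i tens (m i) n.
Proof.
exact: (big_morph (fun m => tens m n) (fun m m' => tensDl m m' n) (tens0l n)).
Qed.

Lemma tensor_ind (P : tensor M N -> Prop) :
  (forall m n, P (tens m n)) -> (forall u v, P u -> P v -> P (u + v)) ->
  forall u, P u.
Proof.
move=> Pt PD u; rewrite -[u]qreprK -(freeg_sumE (qrepr u)) raddf_sum /=.
apply: (big_ind P) => [|//|[m n] _]; first by rewrite -(tens0r 0).
set x := qpi _ _; suff -> : x = tens (coeff (m, n) (qrepr u) *: m) n by [].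
by rewrite tensZl /x freegU_scale; apply: linearZ.
Qed.

Lemma tensor_sum (u : tensor M N) : exists (I : finType) (m : I -> M)
  (n : I -> N), u = \sum_i tens (m i) (n i).
Proof.
move: u; apply: tensor_ind => [m n|_ _ [I [m [n ->]]] [I' [m' [n' ->]]]].
  by exists unit, (fun=> m), (fun=> n); rewrite (big_pred1 tt) // => -[].
exists (I + I')%type, (fun i => match i with inl i => m i | inr i => m' i end).
exists (fun i => match i with inl i => n i | inr i => n' i end).
by rewrite big_sumType.
Qed.

Lemma eq_tensor_linear (W : lmodType A) (f g : {linear tensor M N -> W}) :
  (forall m n, f (tens m n) = g (tens m n)) -> f =1 g.
Proof.
move=> fg; apply: tensor_ind => // u v fu fv.
by rewrite !raddfD; congr (_ + _).
Qed.

End TensorElements.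

Lemma tensor_map_comp (A : comNzRingType) (M M' M'' N N' N'' : lmodType A)
    (f : {linear M -> M'}) (f' : {linear M' -> M''}) (h : {linear M -> M''})
    (g : {linear N -> N'}) (g' : {linear N' -> N''}) (k : {linear N -> N''}) :
  (forall m, f' (f m) = h m) -> (forall n, g' (g n) = k n) ->
  forall u, tensor_map f' g' (tensor_map f g u) = tensor_map h k u.
Proof.
move=> fh gk; apply: tensor_ind => [m n|u v].
  by rewrite !tensor_mapE fh gk.
by rewrite !raddfD => hu hv; congr (_ + _).
Qed.

Lemma tensor_map0l (A : comNzRingType) (M M' N N' : lmodType A)
    (g : {linear N -> N'}) u : tensor_map (lin_zero M M') g u = 0.
Proof.
move: u; apply: tensor_ind => [m n|u v hu hv].
  by rewrite tensor_mapE tens0l.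
by rewrite raddfD /= hu hv addr0.
Qed.

Lemma tensor_map0r (A : comNzRingType) (M M' N N' : lmodType A)
    (f : {linear M -> M'}) u : tensor_map f (lin_zero N N') u = 0.
Proof.
move: u; apply: tensor_ind => [m n|u v hu hv].
  by rewrite tensor_mapE tens0r.
by rewrite raddfD /= hu hv addr0.
Qed.

Section TensorSwap.
Variables (A : comNzRingType).

Definition tensor_swap (M N : lmodType A) : tensor M N -> tensor N M :=
  tensor_lift (fun m n => tens n m).

Fact tensor_swap_bilinear (M N : lmodType A) :
  (forall n : N, linear (fun m : M => tens n m)) *
  (forall m : M, linear (fun n : N => tens n m)).
Proof.
by split=> x a y z; rewrite ?tensDr ?tensDl ?tensZr ?tensZl.
Qed.

Fact tensor_swap_linear (M N : lmodType A) : linear (@tensor_swap M N).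
Proof. by apply: tensor_lift_linear; apply tensor_swap_bilinear. Qed.
HB.instance Definition _ (M N : lmodType A) :=
  GRing.isLinear.Build A (tensor M N) (tensor N M) _ (@tensor_swap M N)
    (@tensor_swap_linear M N).

Lemma tensor_swapE (M N : lmodType A) (m : M) (n : N) :
  tensor_swap (tens m n) = tens n m.
Proof. by apply: tensor_liftE; apply tensor_swap_bilinear. Qed.

Lemma tensor_swapK (M N : lmodType A) :
  cancel (@tensor_swap M N) (@tensor_swap N M).
Proof.
apply: tensor_ind => [m n|u v]; first by rewrite !tensor_swapE.
by rewrite !raddfD /= => hu hv; congr (_ + _).
Qed.

Lemma tensor_swap_map (M M' N N' : lmodType A) (f : {linear M -> M'})
    (g : {linear N -> N'}) u :
  tensor_swap (tensor_map f g u) = tensor_map g f (tensor_swap u).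
Proof.
move: u; apply: tensor_ind => [m n|u v].
  by rewrite !(tensor_mapE, tensor_swapE).
by rewrite !raddfD /= => hu hv; congr (_ + _).
Qed.

End TensorSwap.

(** The quotient of [tensor M Y] by the image of [tensor M X] receives a map
    from [tensor M Z], sending [m (x) g y] to the class of [m (x) y]. *)
Lemma tensor_right_exact (A : comNzRingType) (M X Y Z : lmodType A)
    (f : {linear X -> Y}) (g : {linear Y -> Z}) (v : tensor M Y) :
  exact_at f g -> (forall z, exists y, g y = z) ->
  tensor_map (lin_id M) g v = 0 -> exists u, tensor_map (lin_id M) f u = v.
Proof.
move=> fg /choice[s gs] gv.
pose im w := exists u, tensor_map (lin_id M) f u = w.
have im0 : im 0 by exists 0; rewrite raddf0.
have imL a w w' : im w -> im w' -> im (a *: w + w').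
  by move=> [u <-] [u' <-]; exists (a *: u + u'); rewrite linearP.
pose Q := submod_of im0 imL.
(* the class of m (x) y only depends on g y, so a section s of g will do *)
have kerQ (m : M) y y' : g y = g y' -> qpi Q (tens m y) = qpi Q (tens m y').
  move=> gyy'; apply/eqP; rewrite qpi_eq; apply/submod_ofP.
  have [x fx] : exists x, f x = y - y'.
    by apply/fg; rewrite linearB /= gyy' subrr.
  exists (tens m x); rewrite tensor_mapE /= fx tensDr; congr (_ + _).
  by rewrite -scaleN1r tensZr scaleN1r.
pose b (m : M) z := qpi Q (tens m (s z)).
have bl z : linear (b^~ z).
  by move=> a m m'; rewrite /b tensDl tensZl linearP.
have br m : linear (b m).
  move=> a z z'; rewrite /b -linearP -tensZr -tensDr; apply: kerQ.
  by rewrite linearP !gs.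
have bE w : tensor_lift b (tensor_map (lin_id M) g w) = qpi Q w.
  pose B := GRing.isLinear.Build _ _ _ _ _ (tensor_lift_linear bl br).
  pose b' : {linear _ -> _} := HB.pack (tensor_lift b) B.
  move: w; apply: (@eq_tensor_linear _ _ _ _ (b' \o tensor_map (lin_id M) g)).
  move=> m y /=; rewrite tensor_mapE /= tensor_liftE //.
  by apply: kerQ; rewrite gs.
have : qpi Q v == qpi Q 0.
  by rewrite -!bE gv raddf0.
by rewrite qpi_eq subr0 => /submod_ofP.
Qed.

(** The other variable, by symmetry. *)
Lemma tensor_right_exactl (A : comNzRingType) (N X Y Z : lmodType A)
    (f : {linear X -> Y}) (g : {linear Y -> Z}) (v : tensor Y N) :
  exact_at f g -> (forall z, exists y, g y = z) ->
  tensor_map g (lin_id N) v = 0 -> exists u, tensor_map f (lin_id N) u = v.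
Proof.
move=> fg gs gv.
have [|u uE] := @tensor_right_exact A N X Y Z f g (tensor_swap v) fg gs.
  by rewrite -tensor_swap_map gv raddf0.
exists (tensor_swap u).
by rewrite -tensor_swap_map uE tensor_swapK.
Qed.

(** * Free modules *)

Section FreeModules.
Variable A : comNzRingType.

Lemma free_augE (M : lmodType A) (m : M) : free_aug M << m >> = m.
Proof. by rewrite [LHS]liftU scale1r. Qed.

Lemma free_aug_sum (M : lmodType A) (x : free_on M) (E : seq M) :
  uniq E -> {subset dom x <= E} -> free_aug M x = \sum_(m <- E) coeff m x *: m.
Proof.
move=> Eu xE; rewrite {1}(freeg_sum_sub Eu xE) raddf_sum /=.
by apply: eq_bigr => m _; rewrite linearZ /= free_augE.
Qed.

Section Coordinates.
Variables M N : lmodType A.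

Definition tensor_coord (n : N) : tensor M (free_on N) -> M :=
  tensor_lift (fun m (x : free_on N) => coeff n x *: m).

Fact tensor_coord_bilinear (n : N) :
  (forall x : free_on N, linear (fun m : M => coeff n x *: m)) *
  (forall m : M, linear (fun x : free_on N => coeff n x *: m)).
Proof.
split=> [x a m m'|m a x x']; first by rewrite scalerDr !scalerA mulrC.
by rewrite coeffD coeffZ scalerDl scalerA.
Qed.

Fact tensor_coord_linear n : linear (tensor_coord n).
Proof. by apply: tensor_lift_linear; apply tensor_coord_bilinear. Qed.
HB.instance Definition _ n :=
  GRing.isLinear.Build A (tensor M (free_on N)) M _ (tensor_coord n)
    (tensor_coord_linear n).

Lemma tensor_coordE n m (x : free_on N) :
  tensor_coord n (tens m x) = coeff n x *: m.
Proof. by apply: tensor_liftE; apply tensor_coord_bilinear. Qed.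

(** An element of [tensor M (free_on N)] is the sum of [tens c_n << n >>], where
    the [c_n] are its coordinates and [n] runs through any large enough finite
    set; allowing all larger sets makes the statement additive. *)
Lemma tensor_coord_inj (u : tensor M (free_on N)) :
  (forall n, tensor_coord n u = 0) -> u = 0.
Proof.
suff [D uE] : exists D : seq N,
    u = \sum_(n <- D) tens (tensor_coord n u) << n >>.
  by move=> u0; rewrite uE big1 // => n _; rewrite u0 tens0l.
suff [D uE] : exists D : seq N, forall E, uniq E -> {subset D <= E} ->
    u = \sum_(n <- E) tens (tensor_coord n u) << n >>.
  exists (undup D); apply: uE; first exact: undup_uniq.
  by move=> n; rewrite mem_undup.
move: u; apply: tensor_ind => [m x|u v [D uE] [D' vE]]; last first.
  exists (D ++ D') => E Eu DE.
  have {}uE : u = \sum_(n <- E) tens (tensor_coord n u) << n >>.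
    by apply: uE => // n nD; apply: DE; rewrite mem_cat nD.
  have {}vE : v = \sum_(n <- E) tens (tensor_coord n v) << n >>.
    by apply: vE => // n nD; apply: DE; rewrite mem_cat nD orbT.
  rewrite [LHS](congr2 +%R uE vE) -big_split /=; apply: eq_bigr => n _.
  by rewrite (raddfD (tensor_coord n)) tensDl.
exists (dom x) => E Eu xE.
have xsum : x = \sum_(n <- E) coeff n x *: << n >>.
  exact: freeg_sum_sub.
transitivity (\sum_(n <- E) tens m (coeff n x *: << n >>)).
  by rewrite {1}xsum; apply: (big_morph _ (tensDr m) (tens0r _ m)).
by apply: eq_bigr => n _; rewrite tensor_coordE tensZr -tensZl.
Qed.

End Coordinates.
End FreeModules.

(** * From trivial relations to flatness *)

Section Flatness.
Variables (A : comNzRingType) (M : lmodType A).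

(** Solve the first equation: its solutions are combinations of syzygies, whose
    coefficients satisfy a system with one equation less. *)
Lemma relations_trivial_system (T : Type) (D : seq T) (I : finType)
    (C : T -> I -> A) (y : I -> M) :
  (forall (I : finType) (a : I -> A), relations_trivial M a) ->
  (forall t, \sum_i C t i *: y i = 0) ->
  exists (J : finType) (r : J -> I -> A) (z : J -> M),
    (forall j, all (fun t => `[< \sum_i r j i * C t i = 0 >]) D) /\
    (forall i, y i = \sum_j r j i *: z j).
Proof.
move=> MT; elim: D I C y => [|t D IHD] I C y Cy.
  exists I, (fun j i => (i == j)%:R), y; split=> // i.
  rewrite (bigD1 i) //= eqxx scale1r big1 ?addr0 // => j.
  by rewrite eq_sym => /negPf->; rewrite scale0r.
have [J [r [z [rC yE]]]] := MT I (C t) y (Cy t).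
have [|J' [r' [z' [rC' zE]]]] := IHD J (fun t j => \sum_i r j i * C t i) z.
  move=> t'; rewrite -[RHS](Cy t').
  under eq_bigr do rewrite scaler_suml.
  rewrite exchange_big /=; apply: eq_bigr => i _.
  rewrite yE scaler_sumr; apply: eq_bigr => j _.
  by rewrite scalerA mulrC.
have mulE j' t' : \sum_i (\sum_j r' j' j * r j i) * C t' i =
    \sum_j r' j' j * \sum_i r j i * C t' i.
  under eq_bigr do rewrite mulr_suml.
  rewrite exchange_big /=; apply: eq_bigr => j _.
  by rewrite mulr_sumr; apply: eq_bigr => i _; rewrite mulrA.
exists J', (fun j' i => \sum_j r' j' j * r j i), z'; split=> [j'|i] /=.
  apply/andP; split.
    by apply/asboolP; rewrite mulE big1 // => j _; rewrite rC mulr0.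
  by apply: sub_all (rC' j') => t' /asboolP h; apply/asboolP; rewrite mulE.
rewrite yE; under [LHS]eq_bigr do rewrite zE scaler_sumr.
rewrite exchange_big /=; apply: eq_bigr => j' _.
by rewrite scaler_suml; apply: eq_bigr => j _; rewrite scalerA mulrC.
Qed.

(** The coordinates of the vanishing element form a system of equations in
    [m], finite because finitely many basis elements occur in [x]. *)
Lemma tensor_free_relation (N : lmodType A) (I : finType) (m : I -> M)
    (x : I -> free_on N) :
  (forall (I : finType) (a : I -> A), relations_trivial M a) ->
  \sum_i tens (m i) (x i) = 0 ->
  exists (J : finType) (r : J -> I -> A) (z : J -> M),
    (forall j, \sum_i r j i *: x i = 0) /\
    (forall i, m i = \sum_j r j i *: z j).
Proof.
move=> MT mx.
pose D := flatten [seq dom (x i) | i <- enum I].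
have xD i : {subset dom (x i) <= D}.
  move=> n nx; apply/flattenP; exists (dom (x i)) => //.
  by apply: map_f; rewrite mem_enum.
have [|J [r [z [rx mE]]]] := relations_trivial_system D
    (C := fun n i => coeff n (x i)) (y := m) MT.
  move=> n; rewrite -[RHS](raddf0 (tensor_coord (M := M) n)) -mx raddf_sum.
  by apply: eq_bigr => i _; rewrite /= tensor_coordE.
exists J, r, z; split=> // j; apply/eqP/freeg_eqP => n.
rewrite raddf_sum coeff0 /=; under eq_bigr do rewrite coeffZ.
have [nD|nD] := boolP (n \in D); first by have /asboolP := allP (rx j) n nD.
rewrite big1 // => i _; rewrite coeff_outdom ?mulr0 //.
by apply: contra nD => /xD.
Qed.

Lemma lin_ker_exact (V W : lmodType A) (g : {linear V -> W}) :
  exact_at (val : sub_lmod (lin_ker g) -> V) g.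
Proof.
move=> v; split=> [gv|[x <-]]; last exact/eqP/(valP x).
have kv : v \in lin_ker g by apply/eqP.
by exists (SubLmod kv).
Qed.

Lemma free_aug_surj (N : lmodType A) (n : N) : exists x, free_aug N x = n.
Proof. by exists << n >>; rewrite free_augE. Qed.

(** Let [v = sum_i m_i (x) y_i] die in [tensor M Z].  In [tensor M P], with [P]
    free on [Z], the element [sum_i m_i (x) << g y_i >>] then comes from the
    kernel of [P -> Z], which gives a vanishing sum there.  Resolving it yields
    [m_i = sum_j r_ji z_j] with [sum_i r_ji g y_i = 0], so that
    [v = sum_j z_j (x) sum_i r_ji y_i] has its right factors in the image
    of [f]. *)
Lemma flat_of_relations_trivial :
  (forall (I : finType) (a : I -> A), relations_trivial M a) -> flat M.
Proof.
move=> MT X Y Z f g fg v; split=> [gv|[u <-]]; last first.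
  move: u; apply: tensor_ind => [m x|u u' hu hu'].
    rewrite /= !tensor_mapE /=; have -> : g (f x) = 0 by apply/fg; exists x.
    exact: tens0r.
  by rewrite !raddfD /= hu hu' addr0.
have [I [m [y vE]]] := tensor_sum v.
pose u : tensor M (free_on Z) := \sum_i tens (m i) << g (y i) >>.
have [|w wu] := tensor_right_exact (M := M) (v := u)
    (@lin_ker_exact _ _ (free_aug Z)) (@free_aug_surj Z).
  rewrite -[RHS]gv vE !raddf_sum; apply: eq_bigr => i _.
  by rewrite /= !tensor_mapE /= free_augE.
have [K [m' [l wE]]] := tensor_sum w.
pose mm (i : I + K) := match i with inl i => m i | inr k => m' k end.
pose xx (i : I + K) : free_on Z :=
  match i with inl i => << g (y i) >> | inr k => - val (l k) end.
have [|J [r [z [rx mE]]]] := tensor_free_relation (m := mm) (x := xx) MT.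
  rewrite big_sumType /= -/u -wu wE raddf_sum -big_split big1 //= => k _.
  by rewrite tensor_mapE /= -tensDr subrr tens0r.
have /choice[x xE] j : exists x, f x = \sum_i r j (inl i) *: y i.
  apply/fg; rewrite raddf_sum -[RHS](raddf0 (free_aug Z)) -(rx j).
  rewrite big_sumType raddfD !raddf_sum /= [X in _ + X]big1 ?addr0 => [|k _].
    by apply: eq_bigr => i _; rewrite !linearZ /= free_augE.
  rewrite linearZ raddfN /=; have /eqP-> := valP (l k).
  by rewrite oppr0 scaler0.
exists (\sum_j tens (z j) (x j)); rewrite vE raddf_sum /=.
under eq_bigr do rewrite tensor_mapE /= xE tens_sumr.
rewrite exchange_big /=; apply: eq_bigr => i _.
rewrite -/(mm (inl i)) mE tens_suml; apply: eq_bigr => j _.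
by rewrite tensZr tensZl.
Qed.

End Flatness.

(** * The first Tor module *)

Section TorOne.
Variable A : comNzRingType.

Lemma homology_eq0 (U V W : lmodType A) (f : {linear U -> V})
    (g : {linear V -> W}) :
  (forall x : homology f g, x = 0) <->
  (forall v, g v = 0 -> exists u, f u = v).
Proof.
split=> [H0 v gv|fg x].
  have kv : v \in lin_ker g by apply/eqP.
  have /eqP := H0 (qpi (boundary (g := g) f) (SubLmod kv)).
  rewrite -(raddf0 (qpi (boundary (g := g) f))) qpi_eq subr0.
  by move/asboolP.
rewrite -[x]qreprK; apply/eqP.
rewrite -(raddf0 (qpi (boundary (g := g) f))) qpi_eq subr0; apply/asboolP.
by apply: fg; apply/eqP/(valP (qrepr x)).
Qed.

Variable M : lmodType A.
Local Notation K := (syzygy M 1).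

Lemma free_aug_res_diff (w : res_term M 2) :
  free_aug K (res_diff M 1 w) = 0.
Proof. exact/eqP/(valP (free_aug (syzygy M 2) w)). Qed.

Lemma res_diff_exact : exact_at (res_diff M 1) (free_aug K).
Proof.
move=> v; split=> [gv|[w <-]]; last exact: free_aug_res_diff.
have [x xv] := (lin_ker_exact (free_aug K) v).1 gv.
by exists << x >>; rewrite /= [free_aug _ _]free_augE.
Qed.

(** Chase in the tensor products of [0 -> K -> F -> M -> 0] and
    [0 -> L -> P -> N -> 0], where [F] and [P] are free: a class of [K (x) N]
    dying in [F (x) N] lifts to [K (x) P], then goes to [F (x) L], and its image
    in [M (x) L] vanishes because [M] is flat. *)
Lemma syzygy_tensor_inj (N : lmodType A) (w : tensor K N) : flat M ->
  tensor_map (val : K -> free_on M) (lin_id N) w = 0 -> w = 0.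
Proof.
move=> Mflat w0; pose L := sub_lmod (lin_ker (free_aug N)).
have liftP (u : tensor K N) :
    exists x, tensor_map (lin_id K) (free_aug N) x = u.
  move: u; apply: tensor_ind => [k n|_ _ [x <-] [x' <-]].
    by exists (tens k << n >>); rewrite tensor_mapE /= free_augE.
  by exists (x + x'); rewrite raddfD.
have [x xw] := liftP w.
pose valK : {linear K -> free_on M} := val.
pose valL : {linear L -> free_on N} := val.
have Nexact : exact_at valL (free_aug N) by apply: lin_ker_exact.
have Mexact : exact_at valK (free_aug M) by apply: lin_ker_exact.
pose x' := tensor_map valK (lin_id (free_on N)) x.
have [|y yx'] := tensor_right_exact (M := free_on M) (v := x') Nexact
    (@free_aug_surj A N).
  rewrite (tensor_map_comp (h := valK) (k := free_aug N)) //.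
  by rewrite -[RHS]w0 -xw (tensor_map_comp (h := valK) (k := free_aug N)).
have y0 : tensor_map (free_aug M) (lin_id L) y = 0.
  have Linj : exact_at (lin_zero L L) valL.
    move=> l; split=> [l0|[? <-]]; last exact: raddf0.
    by exists 0; apply: val_inj; rewrite /= [RHS]l0.
  set y' := tensor_map (free_aug M) (lin_id L) y.
  have [|t <-] := (Mflat _ _ _ _ _ Linj y').1; last exact: tensor_map0r.
  rewrite /y' /= (tensor_map_comp (h := free_aug M) (k := valL)) //.
  transitivity (tensor_map (free_aug M) (lin_id (free_on N)) x').
    by rewrite -yx' (tensor_map_comp (h := free_aug M) (k := valL)).
  rewrite (tensor_map_comp (h := lin_zero K M) (k := lin_id (free_on N))) //.
    exact: tensor_map0l.
  by move=> k; apply/eqP/(valP k).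
have [z zy] := tensor_right_exactl Mexact (@free_aug_surj A M) y0.
have zx : x = tensor_map (lin_id K) valL z.
  apply/eqP; rewrite -subr_eq0; apply/eqP/tensor_coord_inj => n.
  have coordE t : val (tensor_coord n t) =
      tensor_coord n (tensor_map valK (lin_id (free_on N)) t).
    move: t; apply: tensor_ind => [k p|t t' ht ht'].
      by rewrite tensor_mapE /= !tensor_coordE.
    by rewrite !raddfD /= ht ht'.
  apply: val_inj; rewrite coordE raddfB /= -/x' -yx' -zy.
  rewrite (tensor_map_comp (h := valK) (k := valL)) //.
  rewrite (tensor_map_comp (h := valK) (k := valL)) //.
  by rewrite subrr !raddf0.
rewrite -xw zx (tensor_map_comp (h := lin_id K) (k := lin_zero L N)) //.
  exact: tensor_map0r.
by move=> l; apply/eqP/(valP l).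
Qed.

Lemma flat_Tor1 (N : lmodType A) : flat M -> forall x : Tor 1 M N, x = 0.
Proof.
move=> Mflat; apply/homology_eq0 => v v0.
apply: (tensor_right_exactl res_diff_exact (@free_aug_surj A K)).
apply: (syzygy_tensor_inj Mflat); rewrite -[RHS]v0.
by apply: tensor_map_comp.
Qed.

Variable m : ideal A.

(** With [K] the kernel of [F -> M], the sum [x = sum_i a_i << y_i >>] lies in
    [K], and [x (x) 1] dies in [F (x) A/m] because the [a_i] kill [A/m].  As
    Tor_1 vanishes it is zero in [K (x) A/m = K/mK].  The map [b] below realizes
    this identification directly on the second term of the resolution. *)
Lemma Tor1_residue_syzygy (I : finType) (a : I -> A) (y : I -> M) :
  (forall x : Tor 1 M (residue_module m), x = 0) ->
  (forall x, x \in m <-> combination a x) -> \sum_i a i *: y i = 0 ->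
  exists k : I -> K,
    \sum_i a i *: << y i >> = val (\sum_i a i *: k i) :> free_on M.
Proof.
move=> /homology_eq0 Tor0 ma ya.
pose mK (x : K) := exists k : I -> K, x = \sum_i a i *: k i.
have mK0 : mK 0 by exists (fun=> 0); rewrite big1 // => i _; rewrite scaler0.
have mKL c x x' : mK x -> mK x' -> mK (c *: x + x').
  move=> [k ->] [k' ->]; exists (fun i => c *: k i + k' i).
  rewrite scaler_sumr -big_split /=; apply: eq_bigr => i _.
  by rewrite scalerDr !scalerA mulrC.
pose Q := submod_of mK0 mKL.
have mQ c x : c \in m -> qpi Q (c *: x) = 0.
  move=> /ma[r ->]; apply/eqP; rewrite -(raddf0 (qpi Q)) qpi_eq subr0.
  apply/submod_ofP; exists (fun i => r i *: x).
  by rewrite scaler_suml; apply: eq_bigr => i _; rewrite scalerA mulrC.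
pose b (w : res_term M 1) (q : residue_module m) :=
  qpi Q ((qrepr q : A) *: free_aug K w).
have bE w (c : A^o) : b w (qpi m c) = qpi Q ((c : A) *: free_aug K w).
  apply/eqP; rewrite -subr_eq0 /b -raddfB -scalerBl; apply/eqP/mQ.
  have /eqP := qreprK (qpi m c).
  by rewrite qpi_eq.
have bl q : linear (b^~ q).
  by move=> c w w'; rewrite /b linearP scalerDr scalerA mulrC -scalerA linearP.
have br w : linear (b w).
  move=> c q q'; rewrite -[q]qreprK -[q']qreprK -linearP !bE.
  by rewrite scalerDl -[(_ *: qrepr q : A) *: _]scalerA linearP.
pose Bl := GRing.isLinear.Build _ _ _ _ _ (tensor_lift_linear bl br).
pose G : {linear _ -> _} := HB.pack (tensor_lift b) Bl.
have GE w q : G (tens w q) = b w q by apply: tensor_liftE.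
have xker : \sum_i a i *: << y i >> \in lin_ker (free_aug M).
  apply/eqP; rewrite raddf_sum -[RHS]ya; apply: eq_bigr => i _.
  by rewrite -[in RHS](free_augE (y i)); apply: linearZ.
pose x : K := SubLmod xker.
have [|u uE] := Tor0 (tens << x >> (qpi m 1)).
  rewrite /= tensor_mapE /= [free_aug _ _]free_augE /= tens_suml big1 // => i _.
  rewrite tensZl -tensZr.
  have -> : a i *: qpi m (1 : A^o) = 0; last exact: tens0r.
  transitivity (qpi m (a i *: (1 : A^o))); first by rewrite linearZ.
  apply/eqP; rewrite -(raddf0 (qpi m)) qpi_eq subr0 /GRing.scale /= mulr1.
  by apply/ma; apply: combination_mem.
have Gd (t : tensor (res_term M 2) (residue_module m)) :
    G (tensor_map (res_diff M 1) (lin_id _) t) = 0.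
  move: t; apply: tensor_ind => [w q|t t' ht ht'].
    by rewrite tensor_mapE GE /b free_aug_res_diff scaler0 raddf0.
  by rewrite [tensor_map _ _ _]raddfD [LHS]raddfD -[RHS]addr0; congr (_ + _).
have : qpi Q x == qpi Q 0.
  rewrite raddf0 -(Gd u) uE GE bE scale1r.
  by rewrite [free_aug _ _]free_augE.
rewrite qpi_eq subr0 => /submod_ofP[k xk].
by exists k; rewrite -xk.
Qed.

(** Lift the relation [y] to a relation [<< y_i >> - k_i] in the free module,
    with [k_i] in the kernel of the augmentation.  Its coordinates are syzygies
    of [a], and applying the augmentation expresses [y] through them. *)
Lemma Tor1_residue_relations_trivial (I : finType) (a : I -> A) :
  (forall x : Tor 1 M (residue_module m), x = 0) ->
  (forall x, x \in m <-> combination a x) -> relations_trivial M a.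
Proof.
move=> Tor0 ma y ya; have [k kE] := Tor1_residue_syzygy Tor0 ma ya.
pose d i : free_on M := << y i >> - val (k i).
have d0 : \sum_i a i *: d i = 0.
  under eq_bigr do rewrite scalerBr.
  by rewrite sumrB kE raddf_sum subrr.
have dy i : free_aug M (d i) = y i.
  rewrite raddfB /= free_augE; have /eqP-> := valP (k i).
  by rewrite subr0.
pose D := undup (flatten [seq dom (d i) | i <- enum I]).
have dD i : {subset dom (d i) <= D}.
  move=> n nx; rewrite mem_undup; apply/flattenP; exists (dom (d i)) => //.
  by apply: map_f; rewrite mem_enum.
exists 'I_(size D), (fun (j : 'I_(size D)) i => coeff D`_j (d i)).
exists (fun j : 'I_(size D) => D`_j).
split=> [j|i].
  rewrite -[RHS](coeff0 A D`_j) -d0 raddf_sum /=.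
  by apply: eq_bigr => i _; rewrite coeffZ mulrC.
rewrite -dy (free_aug_sum (undup_uniq _) (dD i)).
by rewrite (big_nth 0) big_mkord.
Qed.

End TorOne.

Theorem theorem1p1 (A B : comNzRingType) (mA : ideal A) (mB : ideal B)
    (phi : {rmorphism A -> B}) (Y : lmodType B)
    (noethA : noetherian A) (noethB : noetherian B)
    (localA : local_ring mA) (localB : local_ring mB)
    (phi_local : local_morphism mA mB phi)
    (Y_fg : finitely_generated Y) :
  flat (restrict_scalars phi Y) <->
  (forall x : Tor 1 (restrict_scalars phi Y) (residue_module mA), x = 0).
Proof.
split=> [Yflat|Tor0]; first exact: flat_Tor1.
apply: flat_of_relations_trivial.
apply: (relations_trivial_of_maximal noethA noethB localA localB) => // I a.
by apply: Tor1_residue_relations_trivial.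
Qed.
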